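(* Let $K$ be a closed convex cone in $H(M_A,M_B)$. Then the following conditions are equivalent: (a) $K^\circ=K^{\triangleright}$; (b) $K^\circ\subset K^{\triangleright}$; (c) $K\circ \mathbb{CP}_A\subset K$; (d) $K^\circ\circ\mathbb{CP}_A\subset K^\circ$; (e) $K^*\circ K^\circ\subset \mathbb{CP}_A$; (f) $K\subset (K^{\circ})^{\triangleright}$; (g) $K= (K^{\circ})^{\triangleright}$. Likewise, the following conditions are equivalent: (a') $K^\circ=K^{\triangleleft}$; (b') $K^\circ\subset K^{\triangleleft}$; (c') $\mathbb{CP}_B\circ K\subset K$; (d') $\mathbb{CP}_B\circ K^\circ\subset K^\circ$; (e') $K^\circ\circ K^*\subset \mathbb{CP}_B$; (f') $K\subset (K^{\circ})^{\triangleleft}$; (g') $K= (K^{\circ})^{\triangleleft}$.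
   Context: $M_A, M_B$ are the full complex matrix algebras acting on finite-dimensional Hilbert spaces $\mathbb C^A,\mathbb C^B$. $L(M_A,M_B)$ is the space of linear maps $M_A\to M_B$, and $H(M_A,M_B)$ is the real vector space of Hermitian-preserving linear maps, i.e. those with $\phi(a^* )=\phi(a)^*$ for all $a$. On a matrix algebra use the bilinear pairing $\langle a,b\rangle=\operatorname{Tr}(a^{\mathrm t}b)=\sum_{i,j}a_{ij}b_{ij}$ ($\mathrm t$ is transpose; no complex conjugation). The adjoint $\phi^*:M_B\to M_A$ of $\phi\in L(M_A,M_B)$ is defined with respect to this pairing: $\langle\phi(a),b\rangle=\langle a,\phi^*(b)\rangle$ for all $a\in M_A$, $b\in M_B$. The bilinear pairing on $L(M_A,M_B)$ is $\langle\phi,\psi\rangle=\sum_{i,j}\langle\phi(e_{ij}),\psi(e_{ij})\rangle$, with $e_{ij}$ the matrix units of $M_A$. For a subset $K\subset H(M_A,M_B)$: $K^\circ=\{\psi\in H(M_A,M_B):\langle\phi,\psi\rangle\ge 0\text{ for every }\phi\in K\}$ and $K^*=\{\phi^*:\phi\in K\}\subset H(M_B,M_A)$. For sets of maps, $K_1\circ K_0=\{\phi_1\circ\phi_0:\phi_1\in K_1,\phi_0\in K_0\}$. $\mathbb{CP}_A$ (resp. $\mathbb{CP}_B$) is the convex cone of completely positive linear maps $M_A\to M_A$ (resp. $M_B\to M_B$). For a subset $K$ of $H(M_A,M_B)$ define $K^{\triangleright}=(K\circ\mathbb{CP}_A)^\circ$ and $K^{\triangleleft}=(\mathbb{CP}_B\circ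 K)^\circ$. *)

(* Defs.v *)
From HB Require Import structures.
From mathcomp Require Import all_boot all_order all_algebra.
From mathcomp Require Import complex.
From mathcomp Require Import all_classical all_reals all_analysis.

Set Implicit Arguments.
Unset Strict Implicit.
Unset Printing Implicit Defensive.

Import Order.TTheory GRing.Theory Num.Theory.
Import numFieldNormedType.Exports.

Local Open Scope classical_set_scope.
Local Open Scope ring_scope.
Local Open Scope sesquilinear_scope.

Notation Lin C m n := 'Hom('M[C]_m, 'M[C]_n).

Section MapCones.
Variable C : numClosedFieldType.

Definition pairing_mx n (a b : 'M[C]_n) : C := \tr (a^T *m b).

Definition pairing m n (phi psi : Lin C m n) : C :=
  \sum_(i < m) \sum_(j < m)
    pairing_mx (phi (delta_mx i j)) (psi (delta_mx i j)).

Definition hermitian_preserving m n : set (Lin C m n) :=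
  [set phi | forall a : 'M[C]_m, phi (a ^t*) = (phi a) ^t*].

(* In the order of C, 0 <= x says that x is real and nonnegative. *)
Definition psdmx n (A : 'M[C]_n) : Prop :=
  forall v : 'cV[C]_n, 0 <= (v ^t* *m A *m v) 0 0.

(* The block matrix with blocks (a i j) is \sum_(i, j) e_ij (x) a i j, an
   arbitrary element of M_k (x) M_m, and its image under id_k (x) phi is the
   block matrix with blocks phi (a i j). *)
Definition completely_positive m n : set (Lin C m n) :=
  [set phi | forall (k : nat) (a : 'I_k -> 'I_k -> 'M[C]_m),
     psdmx (\mxblock_(i < k, j < k) a i j) ->
     psdmx (\mxblock_(i < k, j < k) phi (a i j))].

Definition CP m : set (Lin C m m) := @completely_positive m m.

Definition adjoint m n (phi : Lin C m n) : Lin C n m :=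
  linfun (fun b => \matrix_(i, j) pairing_mx (phi (delta_mx i j)) b).

Definition star m n (K : set (Lin C m n)) : set (Lin C n m) :=
  [set adjoint phi | phi in K].

Definition polar m n (K : set (Lin C m n)) : set (Lin C m n) :=
  [set psi | hermitian_preserving psi /\
             forall phi, K phi -> 0 <= pairing phi psi].

Definition comp_set m n p (K1 : set (Lin C n p)) (K0 : set (Lin C m n)) :
    set (Lin C m p) :=
  [set (phi1 \o phi0)%VF | phi1 in K1 & phi0 in K0].

Definition rtriangle m n (K : set (Lin C m n)) : set (Lin C m n) :=
  polar (comp_set K (@CP m)).

Definition ltriangle m n (K : set (Lin C m n)) : set (Lin C m n) :=
  polar (comp_set (@CP n) K).

(* lin_mx phi is the matrix of phi with respect to the matrix units, so this is
   the usual topology of the finite-dimensional space of linear maps.  The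
   Hermitian-preserving maps form a closed subset of it, hence for subsets of
   hermitian_preserving, being closed there or in Lin C m n is the same. *)
Definition closed_maps m n (K : set (Lin C m n)) : Prop :=
  closed (K : set (initial_topology
    (fun phi : Lin C m n => lin_mx phi : 'M[C]_(m * m, n * n)))).

(* A cone is nonempty, so that it contains 0.  The scalars 0 <= t in C are the
   nonnegative real numbers. *)
Definition convex_cone m n (K : set (Lin C m n)) : Prop :=
  [/\ K !=set0,
      forall phi psi, K phi -> K psi -> K (phi + psi) &
      forall (t : C) phi, 0 <= t -> K phi -> K (t *: phi)].

Lemma pairing_mxE n (a b : 'M[C]_n) :
  pairing_mx a b = \sum_i \sum_j a i j * b i j.
Proof.
rewrite /pairing_mx /mxtrace exchange_big /=; apply: eq_bigr => j _.
by rewrite mxE; apply: eq_bigr => i _; rewrite mxE.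
Qed.

Lemma pairing_mx_delta n (i j : 'I_n) (b : 'M[C]_n) :
  pairing_mx (delta_mx i j) b = b i j.
Proof.
rewrite pairing_mxE (bigD1 i) //= (bigD1 j) //= mxE !eqxx mul1r.
rewrite big1 ?addr0 => [|l /negPf lj]; last by rewrite mxE lj andbF mul0r.
rewrite big1 ?addr0 // => k /negPf ki.
by rewrite big1 // => l _; rewrite mxE ki mul0r.
Qed.

Lemma adjointE m n (phi : Lin C m n) (b : 'M[C]_n) :
  adjoint phi b = \matrix_(i, j) pairing_mx (phi (delta_mx i j)) b.
Proof.
have lin : linear (fun b => \matrix_(i, j) pairing_mx (phi (delta_mx i j)) b).
  move=> t u v; apply/matrixP => i j.
  by rewrite !mxE /pairing_mx mulmxDr -scalemxAr linearD linearZ.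
pose HL := GRing.isLinear.Build C 'M[C]_n 'M[C]_m *:%R _ lin.
pose f : {linear 'M[C]_n -> 'M[C]_m} := HB.pack (fun b =>
  \matrix_(i, j) pairing_mx (phi (delta_mx i j)) b) HL.
exact: (lfunE f b).
Qed.

Lemma adjointP m n (phi : Lin C m n) (a : 'M[C]_m) (b : 'M[C]_n) :
  pairing_mx (phi a) b = pairing_mx a (adjoint phi b).
Proof.
rewrite adjointE [RHS]pairing_mxE [in LHS](matrix_sum_delta a).
rewrite linear_sum /= /pairing_mx linear_sum mulmx_suml linear_sum.
apply: eq_bigr => i _.
rewrite linear_sum /= linear_sum mulmx_suml linear_sum; apply: eq_bigr => j _.
by rewrite linearZ /= linearZ /= -scalemxAl linearZ /= mxE.
Qed.

Lemma adjoint_unique m n (phi : Lin C m n) (chi : Lin C n m) :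
  (forall a b, pairing_mx (phi a) b = pairing_mx a (chi b)) ->
  chi = adjoint phi.
Proof.
move=> chiP; apply/lfunP => b; apply/matrixP => i j.
by rewrite -!(pairing_mx_delta i j) -chiP adjointP.
Qed.

End MapCones.

Arguments hermitian_preserving : clear implicits.
Arguments completely_positive : clear implicits.
Arguments CP : clear implicits.

(* Main.v *)
(* Everything rests on three facts.  First, the bipolar theorem: the polar of
   the polar of a closed convex cone K is K.  Second, CP is self-dual for the
   pairing and stable under adjoint: by the spectral theorem for Choi matrices
   it is generated by the maps a |-> V a V^*, and pairing such a map with psi
   evaluates the quadratic form of the Choi matrix of psi.  Third,
   <phi o chi, psi> = <phi, psi o chi^*> = <chi, phi^* o psi>, which moves the
   CP factor between the two sides of the pairing.  The second family of
   conditions follows from the same argument with chi o phi for phi o chi and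
   psi o phi^* for phi^* o psi. *)
From HB Require Import structures.
Require Import Defs.
From mathcomp Require Import all_boot all_order all_algebra.
From mathcomp Require Import complex all_classical all_reals all_analysis.
From mathcomp Require Import lra.

Set Implicit Arguments.
Unset Strict Implicit.
Unset Printing Implicit Defensive.

Import Order.TTheory GRing.Theory Num.Theory.
Import numFieldNormedType.Exports.

Local Open Scope classical_set_scope.
Local Open Scope ring_scope.
Local Open Scope sesquilinear_scope.

(** * Positive semidefinite matrices over a numerically closed field *)

Section PositiveMatrices.
Variable C : numClosedFieldType.

Lemma adjmxM m n p (A : 'M[C]_(m, n)) (B : 'M[C]_(n, p)) :
  (A *m B)^t* = B^t* *m A^t*.
Proof. by rewrite trmx_mul map_mxM. Qed.

Lemma mul_delta_mx_colrow m n p q (A : 'M[C]_(m, n)) (B : 'M[C]_(p, q)) i j :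
  A *m delta_mx i j *m B = col i A *m row j B.
Proof.
by rewrite -(mul_delta_mx (0 : 'I_1)) mulmxA -colE -mulmxA -rowE.
Qed.

(** Polarization: the form of [A] takes real values, so the sesquilinear form [q] of [A - A^t*]
    vanishes on the diagonal. Its values at [u + w] and [u + 'i *: w] then force [q u w = 0]. *)
Lemma psdmx_adj n (A : 'M[C]_n) : psdmx A -> A^t* = A.
Proof.
move=> psdA; apply/esym/eqP; rewrite -subr_eq0; set H := A - A^t*.
pose q (u w : 'cV[C]_n) := (u^t* *m H *m w) 0 0.
have qD u v w z : q (u + v) (w + z) = q u w + q u z + (q v w + q v z).
  by rewrite /q [(_ + _)^T]linearD map_mxD !mulmxDl !mulmxDr !mxE.
have qvv v : q v v = 0.
  rewrite /q mulmxBr mulmxBl; apply/eqP.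
  have -> : v^t* *m A^t* *m v = (v^t* *m A *m v)^t*.
    by rewrite !adjmxM trmxCK mulmxA.
  have -> (B : 'M[C]_1) : (B - B^t*) 0 0 = B 0 0 - (B 0 0)^* by rewrite !mxE.
  rewrite subr_eq0 eq_sym.
  by apply/eqP/CrealP/ger0_real.
have qZl c u w : q (c *: u) w = c^* * q u w.
  by rewrite /q [(_ *: _)^T]linearZ map_mxZ -!scalemxAl mxE.
have qZr c u w : q u (c *: w) = c * q u w by rewrite /q -scalemxAr mxE.
have q0 u w : q u w = 0.
  have h1 := qvv (u + w); have h2 := qvv (u + 'i *: w).
  move: h1 h2; rewrite !qD !qZl !qZr !qvv !mulr0 !addr0 !add0r.
  move/eqP; rewrite addr_eq0 => /eqP ->; rewrite conjCi.
  move/eqP; rewrite mulrN -mulNr -mulrDl mulf_eq0 -opprD oppr_eq0.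
  case/orP=> [|/eqP->]; last by rewrite oppr0.
  by rewrite -mulr2n mulrn_eq0 /= (negPf (neq0Ci _)).
apply/eqP/matrixP => i j; rewrite [RHS]mxE -(q0 (delta_mx i 0) (delta_mx j 0)).
rewrite /q -mulmxA -colE trmx_delta map_delta_mx -rowE.
by rewrite !mxE.
Qed.

Lemma psdmx_sum n (A : 'M[C]_n) : psdmx A ->
  exists w : 'I_n -> 'cV[C]_n, A = \sum_t w t *m (w t)^t*.
Proof.
move=> psdA; have hA := psdmx_adj psdA.
have /hermitian_normalmx/orthomx_spectralP : A \is hermsymmx.
  by apply/is_hermitianmxP; rewrite expr0 scale1r hA.
have := spectral_unitarymx A; set P := spectralmx A; set d := spectral_diag A.
move=> uP; rewrite invmx_unitary // => defA.
have d_ge0 t : 0 <= d 0 t.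
  (* The test vector is the eigenvector for [d 0 t], at which the quadratic form equals that
     eigenvalue. *)
  have := psdA (P^t* *m delta_mx t 0); rewrite defA adjmxM trmxCK !mulmxA.
  have PP : P *m P^t* = 1%:M by apply/unitarymxP.
  rewrite -(mulmxA _ P) PP mulmx1 -(mulmxA _ P) PP mulmx1 -mulmxA -colE.
  rewrite trmx_delta map_delta_mx -rowE !mxE eqxx mulr1n; exact.
exists (fun t => sqrtC (d 0 t) *: col t (P^t*)); rewrite {1}defA.
rewrite diag_mx_sum_delta mulmx_sumr mulmx_suml; apply: eq_bigr => t _.
rewrite -[in LHS]scalemxAr -[in LHS]scalemxAl mul_delta_mx_colrow.
rewrite [(_ *: _)^T]linearZ /= map_mxZ -scalemxAl -scalemxAr scalerA /=.
have sE : (sqrtC (d 0 t))^* = sqrtC (d 0 t).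
  by apply/CrealP; rewrite ger0_real ?sqrtC_ge0.
rewrite (_ : _ * _ = d 0 t); last by rewrite sE -expr2 sqrtCK.
congr (_ *: (_ *m _)).
by rewrite tr_col map_row trmxCK.
Qed.

Lemma psdmx_mxblockP k m (a : 'I_k -> 'I_k -> 'M[C]_m) :
  psdmx (\mxblock_(i, j) a i j) <->
  forall v : 'I_k -> 'cV[C]_m,
    0 <= \sum_i \sum_j ((v i)^t* *m a i j *m v j) 0 0.
Proof.
have E (v : 'I_k -> 'cV[C]_m) :
    ((\mxcol_i v i)^t* *m \mxblock_(i, j) a i j *m \mxcol_i v i) 0 0 =
    \sum_i \sum_j ((v i)^t* *m a i j *m v j) 0 0.
  have -> : (\mxcol_i v i)^t* = \mxrow_i (v i)^t*.
    by rewrite tr_mxcol; apply/matrixP => i j; rewrite !mxE.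
  rewrite mul_mxrow_mxblock mul_mxrow_mxcol summxE exchange_big /=.
  by apply: eq_bigr => j _; rewrite mulmx_suml summxE.
split=> [psd v|psd v]; first by rewrite -E; apply: psd.
by rewrite -(submxcolK v) E.
Qed.

End PositiveMatrices.

(** * Choi matrices, Kraus decompositions and self-duality of the completely positive cone *)

Section CompletelyPositive.
Variable C : numClosedFieldType.

Lemma lin_ext m n (phi psi : Lin C m n) :
  (forall i j, phi (delta_mx i j) = psi (delta_mx i j)) -> phi = psi.
Proof.
move=> eq; apply/lfunP => a; rewrite (matrix_sum_delta a) !linear_sum.
apply: eq_bigr => i _; rewrite !linear_sum; apply: eq_bigr => j _.
by rewrite !linearZ /= eq.
Qed.

Definition kraus m n (V : 'M[C]_(n, m)) : Lin C m n :=
  linfun (mulmxr (V^t*) \o mulmx V).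

Lemma krausE m n (V : 'M[C]_(n, m)) a : kraus V a = V *m a *m V^t*.
Proof. by rewrite lfunE. Qed.

Lemma kraus1 m : kraus 1%:M = \1%VF :> Lin C m m.
Proof.
by apply/lfunP => a; rewrite krausE id_lfunE trmx1 map_mx1 mul1mx mulmx1.
Qed.

Lemma kraus_cp m n (V : 'M[C]_(n, m)) : completely_positive C m n (kraus V).
Proof.
move=> k a /psdmx_mxblockP psda; apply/psdmx_mxblockP => v.
have := psda (fun i => V^t* *m v i); congr (0 <= _).
apply: eq_bigr => i _; apply: eq_bigr => j _.
by rewrite krausE adjmxM trmxCK !mulmxA.
Qed.

Definition choi m n (phi : Lin C m n) :=
  \mxblock_(i < m, j < m) phi (delta_mx i j).

(** The Choi matrix is the image of the block matrix with blocks [delta_mx i j], whose quadratic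
    form is the squared modulus of [\sum_i v i i 0]. *)
Lemma choi_psd m n (phi : Lin C m n) :
  completely_positive C m n phi -> psdmx (choi phi).
Proof.
apply; apply/psdmx_mxblockP => v.
suff -> : \sum_(i < m) \sum_(j < m) ((v i)^t* *m delta_mx i j *m v j) 0 0 =
          (\sum_i v i i 0)^* * \sum_i v i i 0 by rewrite mulrC mul_conjC_ge0.
rewrite rmorph_sum mulr_suml; apply: eq_bigr => i _.
rewrite mulr_sumr; apply: eq_bigr => j _.
by rewrite mul_delta_mx_colrow mxE big_ord1 !mxE.
Qed.

(** Each vector [w t] of a rank-one decomposition of the Choi matrix is cut into [m] blocks of
    length [n]; block [i] becomes column [i] of [V t]. *)
Lemma choi_kraus m n (phi : Lin C m n) : psdmx (choi phi) ->
  exists r (V : 'I_r -> 'M[C]_(n, m)), phi = \sum_t kraus (V t).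
Proof.
move=> /psdmx_sum[w defw].
exists _, (fun t => \matrix_(k, i) submxcol (w t) i k 0).
apply: lin_ext => i j; rewrite sum_lfunE.
have := congr1 (fun A => submxblock A i j) defw.
rewrite mxblockK => ->; apply/matrixP => k l; rewrite mxE !summxE.
apply: eq_bigr => t _; rewrite krausE mul_delta_mx_colrow.
by rewrite !mxE !big_ord1 !mxE.
Qed.

Lemma kraus_hermitian m n (V : 'M[C]_(n, m)) :
  hermitian_preserving C m n (kraus V).
Proof. by move=> a; rewrite !krausE !adjmxM trmxCK mulmxA. Qed.

Lemma cp_hermitian m n :
  completely_positive C m n `<=` hermitian_preserving C m n.
Proof.
move=> phi /choi_psd/choi_kraus[r [V ->]] a.
rewrite !sum_lfunE linear_sum /= raddf_sum; apply: eq_bigr => t _.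
exact: kraus_hermitian.
Qed.

Lemma cp_id m : CP C m \1%VF.
Proof. by rewrite -kraus1; apply: kraus_cp. Qed.

Lemma pairingC m n (phi psi : Lin C m n) : pairing phi psi = pairing psi phi.
Proof.
apply: eq_bigr => i _; apply: eq_bigr => j _.
by rewrite !pairing_mxE; do 2!(apply: eq_bigr => ? _); rewrite mulrC.
Qed.

Lemma pairing_sum m n r (phi : 'I_r -> Lin C m n) psi :
  pairing (\sum_t phi t) psi = \sum_t pairing (phi t) psi.
Proof.
rewrite /pairing [RHS]exchange_big; apply: eq_bigr => i _ /=.
rewrite [RHS]exchange_big; apply: eq_bigr => j _ /=.
by rewrite sum_lfunE /pairing_mx linear_sum mulmx_suml linear_sum.
Qed.

(* The pairing with [kraus V] is the quadratic form of the Choi matrix at the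
   entrywise conjugate of V. *)
Lemma pairing_kraus m n (V : 'M[C]_(n, m)) psi :
  pairing (kraus V) psi =
  \sum_i \sum_j ((col i (map_mx Num.conj V))^t* *m psi (delta_mx i j)
                 *m col j (map_mx Num.conj V)) 0 0.
Proof.
apply: eq_bigr => i _; apply: eq_bigr => j _.
rewrite krausE mul_delta_mx_colrow pairing_mxE [RHS]mxE exchange_big /=.
apply: eq_bigr => l _; rewrite !mxE mulr_suml; apply: eq_bigr => k _.
by rewrite mxE big_ord1 !mxE conjCK mulrAC.
Qed.

(** As [V] varies, the pairings with [kraus V] run through all values of the quadratic form of the
    Choi matrix. If these are nonnegative, [psi] is a sum of Kraus maps, each completely
    positive. *)
Lemma cp_dualP m n (psi : Lin C m n) :
  completely_positive C m n psi <-> forall V, 0 <= pairing (kraus V) psi.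
Proof.
split=> [/choi_psd psd V|pos].
  rewrite pairing_kraus.
  by case: (psdmx_mxblockP (fun i j => psi (delta_mx i j))) => + _; apply.
have /choi_kraus[r [V ->]] : psdmx (choi psi).
  apply/psdmx_mxblockP => v.
  (* The entries are conjugated because [pairing_kraus] evaluates the form at the conjugate of
     [V]. *)
  have := pos (\matrix_(k, i) (v i k 0)^*); rewrite pairing_kraus.
  have E i : col i (map_mx Num.conj (\matrix_(k < n, i < m) (v i k 0)^*)) = v i.
    by apply/matrixP => k l; rewrite !mxE ord1 conjCK.
  by under eq_bigr do under eq_bigr do rewrite !E.
move=> k a psda; apply/psdmx_mxblockP => v.
suff -> : \sum_i \sum_j ((v i)^t* *m (\sum_t kraus (V t)) (a i j) *m v j) 0 0 =
    \sum_t \sum_i \sum_j ((v i)^t* *m kraus (V t) (a i j) *m v j) 0 0.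
  by apply: sumr_ge0 => t _; move: v; apply/psdmx_mxblockP; apply: kraus_cp.
rewrite [RHS]exchange_big; apply: eq_bigr => i _ /=.
rewrite [RHS]exchange_big; apply: eq_bigr => j _ /=.
by rewrite sum_lfunE mulmx_sumr mulmx_suml summxE.
Qed.

Lemma cp_pairing_ge0 m n (phi psi : Lin C m n) :
  completely_positive C m n phi -> completely_positive C m n psi ->
  0 <= pairing phi psi.
Proof.
move=> /choi_psd/choi_kraus[r [V ->]] /cp_dualP pos.
by rewrite pairing_sum sumr_ge0.
Qed.

Lemma adjoint_entry m n (phi : Lin C m n) i j k l :
  adjoint phi (delta_mx k l) i j = phi (delta_mx i j) k l.
Proof.
by rewrite adjointE mxE -[RHS]pairing_mx_delta /pairing_mx -mxtrace_tr
           trmx_mul trmxK.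
Qed.

Lemma adjointK m n (phi : Lin C m n) : adjoint (adjoint phi) = phi.
Proof.
by apply: lin_ext => i j; apply/matrixP => k l; rewrite !adjoint_entry.
Qed.

Lemma adjoint_comp m n p (phi : Lin C n p) (chi : Lin C m n) :
  adjoint (phi \o chi)%VF = (adjoint chi \o adjoint phi)%VF.
Proof.
by apply/esym/adjoint_unique => a b; rewrite !comp_lfunE !adjointP.
Qed.

Lemma pairing_adjoint m n (phi psi : Lin C m n) :
  pairing (adjoint phi) (adjoint psi) = pairing phi psi.
Proof.
rewrite /pairing.
under eq_bigr do under eq_bigr do rewrite pairing_mxE.
under [RHS]eq_bigr do under eq_bigr do rewrite pairing_mxE.
under [RHS]eq_bigr do rewrite exchange_big /=.
rewrite [RHS]exchange_big; apply: eq_bigr => k _ /=.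
under [RHS]eq_bigr do rewrite exchange_big /=.
rewrite [RHS]exchange_big; apply: eq_bigr => l _ /=.
by apply: eq_bigr => i _; apply: eq_bigr => j _; rewrite !adjoint_entry.
Qed.

(** The pairing is bilinear, so [V] is transposed without conjugation. *)
Lemma kraus_adjoint m n (V : 'M[C]_(n, m)) : adjoint (kraus V) = kraus V^T.
Proof.
apply/esym/adjoint_unique => a b; rewrite !krausE /pairing_mx.
by rewrite !trmx_mul -map_trmx !trmxK -!mulmxA mxtrace_mulC !mulmxA.
Qed.

Lemma cp_adjoint m n (phi : Lin C m n) :
  completely_positive C m n phi -> completely_positive C n m (adjoint phi).
Proof.
move=> /cp_dualP pos; apply/cp_dualP => V.
by rewrite -pairing_adjoint adjointK kraus_adjoint.
Qed.

Lemma pairing_compl m n p (phi : Lin C n p) (chi : Lin C m n) psi :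
  pairing (phi \o chi)%VF psi = pairing chi (adjoint phi \o psi)%VF.
Proof.
by do 2!(apply: eq_bigr => ? _); rewrite !comp_lfunE adjointP.
Qed.

(** Taking adjoints preserves the pairing and reverses compositions, which reduces this to
    [pairing_compl]. *)
Lemma pairing_compr m n p (phi : Lin C n p) (chi : Lin C m n) psi :
  pairing (phi \o chi)%VF psi = pairing phi (psi \o adjoint chi)%VF.
Proof.
by rewrite -[LHS]pairing_adjoint adjoint_comp pairing_compl -adjoint_comp
           pairing_adjoint.
Qed.

Lemma comp_hermitian m n p (phi : Lin C n p) (chi : Lin C m n) :
  hermitian_preserving C n p phi -> hermitian_preserving C m n chi ->
  hermitian_preserving C m p (phi \o chi)%VF.
Proof. by move=> hphi hchi a; rewrite !comp_lfunE hchi hphi. Qed.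

End CompletelyPositive.

(** * Separation of a point from a closed convex cone in real Euclidean space *)

Section ConeSeparation.
Variables (R : realType) (N : nat).
Implicit Types (S : set 'rV[R]_N) (x y z : 'rV[R]_N).

Lemma continuous_sqdist x : continuous (fun z => \sum_i (z 0 i - x 0 i) ^+ 2).
Proof.
elim: (index_enum _) => [|i s IHs] z.
  rewrite (_ : (fun _ => _) = cst 0); first exact: cst_continuous.
  by apply/funext => w; rewrite big_nil.
rewrite (_ : (fun _ => _) = (fun w : 'rV[R]_N => (w 0 i - x 0 i) ^+ 2 +
  \sum_(j <- s) (w 0 j - x 0 j) ^+ 2)); last first.
  by apply/funext => w; rewrite big_cons.
have cB : {for z, continuous (fun w : 'rV[R]_N => w 0 i - x 0 i)}.
  apply: (@continuousB _ R^o _ (fun w : 'rV[R]_N => w 0 i) (cst (x 0 i))).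
    exact: coord_continuous.
  exact: cst_continuous.
apply: (@continuousD _ R^o _ (fun w : 'rV[R]_N => (w 0 i - x 0 i) ^+ 2)).
  exact: (continuousM cB cB).
exact: IHs.
Qed.

(** Only the points of [S] at least as close to [x] as some [s0] matter; they form a compact set, on
    which the distance attains its minimum. *)
Lemma sqdist_min S x : closed S -> S !=set0 ->
  exists2 p, S p & forall z, S z ->
    \sum_i (p 0 i - x 0 i) ^+ 2 <= \sum_i (z 0 i - x 0 i) ^+ 2.
Proof.
move=> clS [s0 Ss0]; pose f z := \sum_i (z 0 i - x 0 i) ^+ 2.
pose A := S `&` [set z | f z <= f s0].
have clA : closed A.
  apply: closedI => //.
  have /continuous_closedP cl := @continuous_sqdist x.
  exact: (cl [set t | t <= f s0] (@closed_le _ _)).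
have bA : bounded_set A.
  (* Each [z 0 j - x 0 j] has square at most [f s0], hence absolute value at most [f s0 + 1]; the
     sum bounds the coordinates of [x]. *)
  exists (f s0 + 1 + \sum_i `|x 0 i|); split; first exact: num_real.
  move=> M ltM z [_ /= fz].
  have M0 : 0 <= M.
    apply/ltW/(le_lt_trans _ ltM); rewrite !addr_ge0 ?sumr_ge0 // => i _.
    exact: sqr_ge0.
  rewrite [leLHS]mx_normrE; apply/bigmax_leP; split => //= -[i j] _ /=.
  rewrite (ord1 i) -(subrK (x 0 j) (z 0 j)) (le_trans (ler_normD _ _)) //.
  apply: (le_trans _ (ltW ltM)); apply: lerD; last first.
    by rewrite (bigD1 j) //= lerDl sumr_ge0.
  have le1 : `|z 0 j - x 0 j| ^+ 2 <= f s0.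
    rewrite real_normK ?num_real // (le_trans _ fz) // /f (bigD1 j) //= lerDl.
    by rewrite sumr_ge0 // => k _; exact: sqr_ge0.
  have := normr_ge0 (z 0 j - x 0 j); move: le1; nra.
have [|||p pA pmin] := @EVT_min_rV R N f A.
- by exists s0; split => //=.
- exact: bounded_closed_compact.
- exact/continuous_subspaceT/continuous_sqdist.
move: pA; rewrite inE => -[Sp /= fp]; exists p => // z Sz.
have [fz|/ltW fz] := leP (f z) (f s0); last exact: le_trans fz.
by apply: pmin; rewrite inE; split.
Qed.

(* The separating vector is p - x, where p is the point of the cone closest
   to x. *)
Lemma cone_separation S x : closed S -> S !=set0 ->
  (forall y z, S y -> S z -> S (y + z)) ->
  (forall (t : R) z, 0 <= t -> S z -> S (t *: z)) ->
  ~ S x -> exists y, (forall z, S z -> 0 <= \sum_i z 0 i * y 0 i) /\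
                    \sum_i x 0 i * y 0 i < 0.
Proof.
pose dot x y := \sum_i x 0 i * y 0 i.
move=> clS S0 addS scaleS nSx; have [p Sp pmin] := sqdist_min x clS S0.
have [y yE] : exists y, y = p - x by exists (p - x).
exists y; rewrite -/(dot x y).
have dotDl u v w : dot (u + v) w = dot u w + dot v w.
  by rewrite -big_split; apply: eq_bigr => i _; rewrite mxE mulrDl.
have dotZl (t : R) u w : dot (t *: u) w = t * dot u w.
  by rewrite mulr_sumr; apply: eq_bigr => i _; rewrite mxE mulrA.
have dotC u w : dot u w = dot w u by apply: eq_bigr => i _; rewrite mulrC.
have dot_ge0 u : 0 <= dot u u by apply: sumr_ge0 => i _; rewrite -expr2 sqr_ge0.
have pmin' z : S z -> dot y y <= dot (z - x) (z - x).
  rewrite yE.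
  have sqE (u : 'rV[R]_N) : \sum_i (u 0 i - x 0 i) ^+ 2 = dot (u - x) (u - x).
    by apply: eq_bigr => i _; rewrite !mxE expr2.
  by move=> /pmin; rewrite !sqE.
(* First-order condition at the minimum [p], for a direction [z] that stays in [S]: the squared
   distance changes by [t * (2 * dot z y + t * q)]. *)
have var z : (forall t : R, 0 < t -> t <= 1 -> S (p + t *: z)) -> 0 <= dot z y.
  move=> Sz; rewrite leNgt; apply/negP => zy.
  pose q := dot z z; have q0 : 0 <= q := dot_ge0 z.
  have key (t : R) : 0 < t -> t <= 1 -> 0 <= 2 * dot z y + t * q.
    move=> t0 t1; have := pmin' _ (Sz t t0 t1).
    have -> : p + t *: z - x = y + t *: z by rewrite yE addrAC.
    rewrite dotDl dotZl [dot y (y + _)]dotC [dot z (y + _)]dotC !dotDl !dotZl.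
    rewrite (dotC y z) -/q => h.
    have : 0 <= t * (2 * dot z y + t * q) by lra.
    by rewrite pmulr_rge0.
  have d0 : 0 < q + - dot z y by lra.
  (* This [t] lies in []0, 1]], even if [q = 0], and satisfies [t * q <= - dot z y], so that
     [2 * dot z y + t * q <= dot z y < 0]. *)
  have := key (- dot z y / (q + - dot z y)).
  rewrite divr_gt0 ?oppr_gt0 // ler_pdivrMr // mul1r lerDr q0.
  move=> /(_ isT isT).
  have : - dot z y / (q - dot z y) * q <= - dot z y.
    by rewrite mulrAC ler_pdivrMr // ler_wpM2l //; lra.
  lra.
(* Both directions [- p] and [p] are admissible: the ray through [p] stays in the cone. *)
have py : dot p y = 0.
  apply/eqP; rewrite eq_le -oppr_ge0 -mulN1r -dotZl; apply/andP; split.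
    apply: var => t t0 t1; rewrite scalerA mulrN1 -{1}(scale1r p) -scalerDl.
    by apply: scaleS => //; lra.
  by apply: var => t t0 t1; apply: addS => //; apply: scaleS => //; lra.
split=> [z Sz|].
  rewrite -/(dot z y).
  by apply: var => t t0 t1; apply: addS => //; apply: scaleS => //; lra.
have -> : dot x y = - dot y y.
  have -> : x = p - y by rewrite yE subKr.
  by rewrite dotDl py add0r -scaleN1r dotZl mulN1r.
rewrite oppr_lt0 lt_def dot_ge0 andbT; apply/eqP => yy0; apply: nSx.
suff <- : p = x by [].
apply/eqP; rewrite -subr_eq0 -yE; apply/eqP/rowP => i; rewrite [RHS]mxE.
apply/eqP; rewrite -sqrf_eq0 expr2.
move/eqP: yy0; rewrite psumr_eq0 => [/allP/(_ i)|k _]; last first.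
  by rewrite -expr2 sqr_ge0.
by rewrite mem_index_enum => /(_ isT).
Qed.

End ConeSeparation.

(** * Matrix coordinates and conjugation of linear maps *)

Definition lin_of_mx (C : numClosedFieldType) m n (A : 'M[C]_(m * m, n * n)) :
    Lin C m n :=
  linfun (vec_mx \o mulmxr A \o mxvec).

Lemma lin_of_mxE (C : numClosedFieldType) m n (A : 'M[C]_(m * m, n * n)) a :
  lin_of_mx A a = vec_mx (mxvec a *m A).
Proof. by rewrite lfunE. Qed.

Lemma lin_of_mxK (C : numClosedFieldType) m n (A : 'M[C]_(m * m, n * n)) :
  lin_mx (lin_of_mx A) = A.
Proof.
apply/row_matrixP => i.
by rewrite !rowE mul_rV_lin [X in mxvec X]lin_of_mxE !vec_mxK.
Qed.

Lemma lin_mxK (C : numClosedFieldType) m n (phi : Lin C m n) :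
  lin_of_mx (lin_mx phi) = phi.
Proof. by apply/lfunP => a; rewrite lin_of_mxE mx_vec_lin. Qed.

Lemma lin_mx_index (C : numClosedFieldType) m n (phi : Lin C m n) i j k l :
  lin_mx phi (mxvec_index i j) (mxvec_index k l) = phi (delta_mx i j) k l.
Proof. by rewrite !mxE /= vec_mx_delta mxvecE. Qed.

Lemma sum_mxvec_index (V : nmodType) p q (F : 'I_(p * q) -> V) :
  \sum_a F a = \sum_i \sum_j F (mxvec_index i j).
Proof.
rewrite (reindex _ (curry_mxvec_bij _ _)) pair_bigA.
by apply: eq_bigr => -[].
Qed.

(** Expresses the pairing in the coordinates that define the topology of [closed_maps]. *)
Lemma pairing_lin_mx (C : numClosedFieldType) m n (phi psi : Lin C m n) :
  pairing phi psi = \sum_a \sum_b lin_mx phi a b * lin_mx psi a b.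
Proof.
rewrite sum_mxvec_index; apply: eq_bigr => i _; apply: eq_bigr => j _.
rewrite sum_mxvec_index pairing_mxE.
apply: eq_bigr => k _; apply: eq_bigr => l _.
by rewrite !lin_mx_index.
Qed.

(** The antilinear involution whose fixed points are the Hermitian-preserving maps. *)
Definition conj_lin (C : numClosedFieldType) m n (phi : Lin C m n) :
    Lin C m n :=
  linfun (fun a => (phi (a^t*))^t*).

Lemma conj_linE (C : numClosedFieldType) m n (phi : Lin C m n) a :
  conj_lin phi a = (phi (a^t*))^t*.
Proof.
have adjmx_semilinear p q (t : C) (A B : 'M[C]_(p, q)) :
    (t *: A + B)^t* = t^* *: A^t* + B^t*.
  by apply/matrixP => i j; rewrite !mxE rmorphD rmorphM.
have lin : linear (fun a : 'M[C]_m => (phi (a^t*))^t*).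
  by move=> t u v; rewrite adjmx_semilinear linearP adjmx_semilinear conjCK.
pose f : {linear 'M[C]_m -> 'M[C]_n} := HB.pack
  (fun a : 'M[C]_m => (phi (a^t*))^t*)
  (GRing.isLinear.Build C 'M[C]_m 'M[C]_n *:%R _ lin).
exact: (lfunE f a).
Qed.

Lemma conj_lin_hermitian (C : numClosedFieldType) m n (phi : Lin C m n) :
  hermitian_preserving C m n (phi + conj_lin phi).
Proof.
move=> a; rewrite !add_lfunE !conj_linE trmxCK.
by rewrite [(_ + _)^T]linearD map_mxD trmxCK addrC.
Qed.

(** The conjugate transpose permutes the matrix units, so exchanging the indices of both double sums
    leaves only entrywise conjugation. *)
Lemma pairing_conj_lin (C : numClosedFieldType) m n (phi psi : Lin C m n) :
  hermitian_preserving C m n phi ->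
  pairing phi (conj_lin psi) = (pairing phi psi)^*.
Proof.
move=> herm; rewrite /pairing rmorph_sum [LHS]exchange_big.
apply: eq_bigr => i _ /=.
rewrite rmorph_sum; apply: eq_bigr => j _.
rewrite conj_linE trmx_delta map_delta_mx.
have -> : delta_mx j i = (delta_mx i j)^t* :> 'M[C]_m.
  by rewrite trmx_delta map_delta_mx.
rewrite herm !pairing_mxE rmorph_sum [LHS]exchange_big.
apply: eq_bigr => k _ /=.
rewrite rmorph_sum; apply: eq_bigr => l _ /=.
by rewrite rmorphM !mxE.
Qed.

Lemma pairingD (C : numClosedFieldType) m n (phi psi chi : Lin C m n) :
  pairing phi (psi + chi) = pairing phi psi + pairing phi chi.
Proof.
rewrite -big_split; apply: eq_bigr => i _; rewrite -big_split.
by apply: eq_bigr => j _; rewrite add_lfunE /pairing_mx mulmxDr linearD.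
Qed.

(** * The bipolar theorem, by passing to real coordinates *)

Section Bipolar.
Local Open Scope complex_scope.

Section Complexify.
Variables (R : realType) (p q : nat).
Implicit Types (v w : 'rV[R]_(p * q + p * q)) (A : 'M[R[i]]_(p, q)).

Definition complexify v : 'M[R[i]]_(p, q) := \matrix_(i, j)
  (v 0 (lshift _ (mxvec_index i j)) +i* v 0 (rshift _ (mxvec_index i j))).

Definition realify A : 'rV[R]_(p * q + p * q) :=
  row_mx (mxvec (map_mx (@complex.Re R) A)) (mxvec (map_mx (@complex.Im R) A)).

Lemma realifyK A : complexify (realify A) = A.
Proof.
apply/matrixP => i j; rewrite mxE row_mxEl row_mxEr !mxvecE !mxE.
by case: (A i j).
Qed.

Lemma complexifyD v w : complexify (v + w) = complexify v + complexify w.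
Proof. by apply/matrixP => i j; rewrite !mxE. Qed.

Lemma complexifyZ (t : R) v : complexify (t *: v) = t%:C *: complexify v.
Proof.
apply/matrixP => i j; rewrite !mxE; apply/eqP.
by rewrite eq_complex /= !mul0r subr0 addr0 !eqxx.
Qed.

Lemma complexify_continuous :
  continuous (complexify : 'rV[R]_(_) -> 'M[R[i] : numClosedFieldType]_(p, q)).
Proof.
move=> v B /nbhs_ballP[e e0 Be]; apply/nbhs_ballP.
case: e e0 Be => e1 e2; rewrite /= ltcE /= => /andP[/eqP-> e10] Be.
(* If the real and imaginary parts both change by less than [e1 / 2], the modulus changes by less
   than [e1]. *)
exists (e1 / 2); first by rewrite /= divr_gt0.
move=> w [_ vw]; apply: Be; split; first by rewrite ltcE /= eqxx.
move=> i j; rewrite /ball /= !mxE.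
have := vw 0 (lshift _ (mxvec_index i j)).
have := vw 0 (rshift _ (mxvec_index i j)).
rewrite /ball /= normc_def ltcR => hb ha /=.
rewrite -[ltRHS](ger0_norm (ltW e10)) -sqrtr_sqr ltr_sqrt ?exprn_gt0 //.
move: ha hb; rewrite !ltr_norml; set a := v 0 _ - w 0 _; set b := v 0 _ - w 0 _.
move=> /andP[a1 a2] /andP[b1 b2]; nra.
Qed.

(** The conjugation makes the real part the Euclidean inner product: both the real and the imaginary
    parts contribute with a plus sign. *)
Lemma Re_sum_complexify A v :
  complex.Re (\sum_i \sum_j A i j * Num.conj (complexify v i j)) =
  \sum_k realify A 0 k * v 0 k.
Proof.
have ReD : {morph @complex.Re R : x y / x + y} by case=> ? ? [].
rewrite (big_morph _ ReD (erefl : complex.Re 0 = 0)).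
under eq_bigr do rewrite (big_morph _ ReD (erefl : complex.Re 0 = 0)).
rewrite big_split_ord /= !sum_mxvec_index -big_split; apply: eq_bigr => i _.
rewrite -big_split; apply: eq_bigr => j _.
rewrite /realify row_mxEl row_mxEr !mxvecE !mxE.
by case: (A i j) => a b /=; rewrite mulrN opprK.
Qed.

End Complexify.

(* A real separating functional need not come from a Hermitian-preserving map;
   adding to psi0 its conjugate makes it so and only doubles its real part on
   Hermitian-preserving maps. *)
Lemma bipolar (R : realType) (m n : nat) (K : set (Lin R[i] m n)) :
  K `<=` hermitian_preserving R[i] m n ->
  convex_cone K ->
  closed_maps K -> polar (polar K) = K.
Proof.
move=> hK [[phi0 Kphi0] addK scaleK] clK.
apply/seteqP; split; last first.
  move=> phi Kphi; split; first exact: hK.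
  by move=> psi [_ pos]; rewrite pairingC pos.
move=> x [hx posx]; apply: contrapT => nKx.
pose g (v : 'rV[R]_(m * m * (n * n) + m * m * (n * n))) : Lin R[i] m n :=
  lin_of_mx (complexify v).
have fK (phi : Lin R[i] m n) : g (realify (lin_mx phi)) = phi.
  by rewrite /g realifyK lin_mxK.
have gD v w : g (v + w) = g v + g w.
  rewrite /g complexifyD; apply/lfunP => a.
  by rewrite add_lfunE !lin_of_mxE mulmxDr linearD.
have gZ (t : R) v : g (t *: v) = t%:C *: g v.
  rewrite /g complexifyZ; apply/lfunP => a.
  by rewrite scale_lfunE !lin_of_mxE -scalemxAr linearZ.
have clS : closed (g @^-1` K).
  rewrite -openC.
  (* In the initial topology the complement of [K] is the preimage under [lin_mx] of an open set [B]
     of matrices. *)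
  move: clK; rewrite /closed_maps -openC => -[B opB BK].
  have -> : ~` (g @^-1` K) = @complexify R (m * m) (n * n) @^-1` B.
    rewrite preimage_setC -BK; apply/funext => v.
    by rewrite /preimage /= lin_of_mxK.
  have /continuousP := @complexify_continuous R (m * m) (n * n).
  exact.
have [||||y [posy ltxy]] := @cone_separation _ _ _ (realify (lin_mx x)) clS.
- by exists (realify (lin_mx phi0)); rewrite /= fK.
- by move=> v w Kv Kw; rewrite /= gD; apply: addK.
- by move=> t v t0 Kv; rewrite /= gZ; apply: scaleK; rewrite ?ler0c.
- by rewrite /= fK.
(* The conjugate turns the Euclidean functional given by [y] into the real part of the bilinear
   pairing with [psi0]. *)
pose psi0 : Lin R[i] m n := lin_of_mx (map_mx Num.conj (complexify y)).
pose psi := psi0 + conj_lin psi0.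
have pairE (phi : Lin R[i] m n) : hermitian_preserving R[i] m n phi ->
    pairing phi psi = (2 * \sum_k realify (lin_mx phi) 0 k * y 0 k)%:C.
  move=> hphi; rewrite pairingD pairing_conj_lin // addcJ rmorphM rmorph_nat.
  congr (_ * _%:C); rewrite pairing_lin_mx lin_of_mxK -Re_sum_complexify.
  congr (complex.Re _).
  by do 2!(apply: eq_bigr => ? _); congr (_ * _); rewrite [LHS]mxE.
have Ppsi : polar K psi.
  split=> [|phi Kphi]; first exact: conj_lin_hermitian.
  rewrite pairE ?ler0c ?mulr_ge0 //; last exact: hK.
  by apply: posy; rewrite /= fK.
have := posx psi Ppsi; rewrite pairingC pairE // ler0c; lra.
Qed.

End Bipolar.

(** * The cycle of equivalences for an abstract action of CP *)

Section CPAction.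
Variables (C : numClosedFieldType) (m n p : nat).
(** Composition with a CP map on either side is an instance of [act]. The map [gram phi psi]
    represents [chi |-> <act chi phi, psi>] for the pairing. *)
Variables (act : Lin C p p -> Lin C m n -> Lin C m n).
Variables (gram : Lin C m n -> Lin C m n -> Lin C p p).
Hypothesis act_id : forall phi, act \1%VF phi = phi.
Hypothesis act_hermitian : forall chi phi,
  hermitian_preserving C p p chi -> hermitian_preserving C m n phi ->
  hermitian_preserving C m n (act chi phi).
Hypothesis pairing_gram : forall chi phi psi,
  pairing (act chi phi) psi = pairing chi (gram phi psi).
Hypothesis pairing_act : forall chi phi psi,
  pairing (act chi phi) psi = pairing phi (act (adjoint chi) psi).

Let orbit (K : set (Lin C m n)) := [set act chi phi | chi in CP C p & phi in K].
Let grams (K L : set (Lin C m n)) := [set gram phi psi | phi in K & psi in L].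

Lemma sub_orbit (K : set (Lin C m n)) : K `<=` orbit K.
Proof.
by move=> phi Kphi; exists \1%VF; [exact: cp_id|exists phi; rewrite ?act_id].
Qed.

Lemma polar_anti (K L : set (Lin C m n)) : K `<=` L -> polar L `<=` polar K.
Proof. by move=> KL psi [hpsi pos]; split=> // phi /KL/pos. Qed.

Lemma cone_tfae (K : set (Lin C m n)) :
  K `<=` hermitian_preserving C m n -> polar (polar K) = K ->
  [<-> polar K = polar (orbit K);
       polar K `<=` polar (orbit K);
       orbit K `<=` K;
       orbit (polar K) `<=` polar K;
       grams K (polar K) `<=` CP C p;
       K `<=` polar (orbit (polar K));
       K = polar (orbit (polar K))].
Proof.
move=> hK KE.
have herm_orbit (L : set (Lin C m n)) : L `<=` hermitian_preserving C m n ->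
    orbit L `<=` hermitian_preserving C m n.
  move=> hL _ [chi /cp_hermitian hchi [phi /hL hphi <-]].
  exact: act_hermitian.
have hP : polar K `<=` hermitian_preserving C m n by move=> psi [].
tfae.
- by move=> ->.
(* By the bipolar theorem, membership in [K] is tested against [polar K]. *)
- move=> sub phi Ophi; rewrite -KE; split; first exact: herm_orbit Ophi.
  by move=> psi /sub[_ pos]; rewrite pairingC pos.
- move=> sub psi Opsi; split; first exact: herm_orbit Opsi.
  case: Opsi => chi cpchi [psi' [_ pos] <-] phi Kphi.
  rewrite pairingC pairing_act pairingC; apply/pos/sub.
  by exists (adjoint chi); [exact: cp_adjoint|exists phi].
(* By self-duality it suffices to pair with [kraus V], whose adjoint acts on [psi] within
   [polar K]. *)
- move=> sub _ [phi Kphi [psi Ppsi <-]]; apply/cp_dualP => V.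
  rewrite -pairing_gram pairing_act.
  case: (sub (act (adjoint (kraus V)) psi)) => [|_]; last exact.
  by exists (adjoint (kraus V)); [exact/cp_adjoint/kraus_cp|exists psi].
- move=> sub phi Kphi; split; first exact: hK.
  move=> _ [chi cpchi [psi Ppsi <-]].
  rewrite pairing_act pairingC pairing_gram; apply: cp_pairing_ge0.
    exact: cp_adjoint.
  by apply: sub; exists phi => //; exists psi.
(* The reverse inclusion is automatic: the orbit contains [polar K], so its polar lies in the
   bipolar [K]. *)
- move=> sub; apply/seteqP; split=> //; rewrite -{2}KE.
  exact/polar_anti/sub_orbit.
- move=> KO; apply/seteqP; split; last exact/polar_anti/sub_orbit.
  move=> psi Ppsi; split; first exact: hP.
  move=> _ [chi cpchi [phi Kphi <-]].
  rewrite pairing_act pairingC; move: Kphi; rewrite KO => -[_]; apply.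
  by exists (adjoint chi); [exact: cp_adjoint|exists psi].
Qed.

End CPAction.

(** * The two families of conditions, from right and left composition *)

Local Open Scope complex_scope.

Theorem proposition2p1 (R : realType) (m n : nat) (K : set (Lin R[i] m n)) :
  K `<=` hermitian_preserving R[i] m n ->
  convex_cone K ->
  closed_maps K ->
  [<-> polar K = rtriangle K;
       polar K `<=` rtriangle K;
       comp_set K (CP R[i] m) `<=` K;
       comp_set (polar K) (CP R[i] m) `<=` polar K;
       comp_set (star K) (polar K) `<=` CP R[i] m;
       K `<=` rtriangle (polar K);
       K = rtriangle (polar K)] /\
  [<-> polar K = ltriangle K;
       polar K `<=` ltriangle K;
       comp_set (CP R[i] n) K `<=` K;
       comp_set (CP R[i] n) (polar K) `<=` polar K;
       comp_set (polar K) (star K) `<=` CP R[i] n;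
       K `<=` ltriangle (polar K);
       K = ltriangle (polar K)].
Proof.
move=> hK cK clK; have KE := bipolar hK cK clK; rewrite /rtriangle /ltriangle.
split.
(* The orbit of [cone_tfae] takes the CP factor first, so the two image parameters are exchanged. *)
- have orbitE (L : set (Lin R[i] m n)) : comp_set L (CP R[i] m) =
      [set (phi \o chi)%VF | chi in CP R[i] m & phi in L].
    by apply/seteqP; split=> _ [x ? [y ? <-]]; exists y => //; exists x.
  rewrite !orbitE.
  have -> : comp_set (star K) (polar K) =
      [set (adjoint phi \o psi)%VF | phi in K & psi in polar K].
    apply/seteqP; split=> [_ [_ [x ? <-] [y ? <-]]|_ [x ? [y ? <-]]].
      by exists x => //; exists y.
    by exists (adjoint x); [exists x|exists y].
  apply: (@cone_tfae _ _ _ _ (fun chi phi => (phi \o chi)%VF)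
                             (fun phi psi => (adjoint phi \o psi)%VF)) => //.
  + by move=> phi; apply: comp_lfun1r.
  + by move=> chi phi hchi hphi; apply: comp_hermitian.
  + by move=> chi phi psi; apply: pairing_compl.
  + by move=> chi phi psi; apply: pairing_compr.
- have -> : comp_set (polar K) (star K) =
      [set (psi \o adjoint phi)%VF | phi in K & psi in polar K].
    apply/seteqP; split=> [_ [x ? [_ [y ? <-] <-]]|_ [x ? [y ? <-]]].
      by exists y => //; exists x.
    by exists y => //; exists (adjoint x) => //; exists x.
  (* For left composition [pairing_compl] and [pairing_compr] exchange their roles. *)
  apply: (@cone_tfae _ _ _ _ (fun chi phi => (chi \o phi)%VF)
                             (fun phi psi => (psi \o adjoint phi)%VF)) => //.
  + by move=> phi; apply: comp_lfun1l.
  + by move=> chi phi; apply: comp_hermitian.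
  + by move=> chi phi psi; apply: pairing_compr.
  + by move=> chi phi psi; apply: pairing_compl.
Qed.
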